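(* Let $\mu$ be a translation invariant probability measure on $\mathbb{N}^{\mathbb{Z}}$ such that $\mathbb{E}_\mu(\eta(0))=1$ and such that $\frac{1}{\sqrt{n}}\sum_{x=-n}^{n}(\eta(x)-1)$ converges in distribution, as $n\to\infty$, to a nondegenerate normal random variable. Then $\mu$ is not stabilizable.
   Context: Sandpile model on $\mathbb{Z}$ ($d=1$): a configuration $\eta\in\mathbb{N}^{\mathbb{Z}}$ is stable if $\eta(x)\le 1$ for all $x$; toppling an unstable site $x$ ($\eta(x)\ge 2$) removes 2 grains from $x$ and adds one to each of $x\pm1$. A toppling procedure is a measurable map $T:[0,\infty)\times\mathbb{Z}\times\mathbb{N}^{\mathbb{Z}}\to\mathbb{N}$ ($T(t,x,\eta)$ = number of topplings at $x$ up to time $t$) with $T(0,\cdot,\eta)=0$, $t\mapsto T(t,x,\eta)$ right-continuous, nondecreasing, with jumps of size at most one and finitely many jumps in finite time intervals, and with no infinite chain of topplings at neighboring sites occurring at decreasing times. It is legal if only unstable sites of the current configuration $\eta-\Delta T(t-,\cdot,\eta)$ topple, where $\Delta_{x,y}=2\mathbf{1}_{x=y}-\mathbf{1}_{|x-y|=1}$. A configuration is stabilizable if some legal toppling procedure has $T(\infty,x,\eta)<\infty$ for all $x$ and stable final configuration $\eta-\Delta T(\infty,\cdot,\eta)$; a measure $\mu$ is stabilizable if $\mu$-a.e. configuration is stabilizable. *)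

(* Defs.v *)
From HB Require Import structures.
From mathcomp Require Import all_boot all_order all_algebra.
From mathcomp Require Import all_classical all_reals all_analysis.
Set Implicit Arguments. Unset Strict Implicit. Unset Printing Implicit Defensive.
Import Order.TTheory GRing.Theory Num.Theory.
Import numFieldNormedType.Exports.
Local Open Scope classical_set_scope.
Local Open Scope ring_scope.

Definition config := int -> nat.

Definition cylinders : set (set config) :=
  [set A | exists (x : int) (n : nat), A = [set eta | eta x = n]].

Definition Config := g_sigma_algebraType cylinders.

Definition shift (eta : Config) : Config := fun x => eta (x + 1)%R.

Definition translation_invariant (R : realType)
    (mu : probability Config R) : Prop :=
  forall A : set Config, measurable A -> mu (shift @^-1` A) = mu A.

Definition Sn (R : realType) (n : nat) (eta : Config) : R :=
  (Num.sqrt (n%:R : R))^-1 *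
  \sum_(i < (2 * n).+1) (((eta (i%:Z - n%:Z)%R)%:R : R) - 1).

(* Convergence in distribution of (X_n) under mu to the normal law N(m, s^2)
   (library normal_prob m s, mean m, standard deviation s):
   E[f(X_n)] -> int f dN(m,s^2) for every bounded continuous f : R -> R. *)
Definition cvg_in_distribution_normal (R : realType) (d : measure_display)
    (T : measurableType d) (mu : probability T R) (X : nat -> T -> R)
    (m s : R) : Prop :=
  forall f : R -> R, continuous f -> (exists M : R, forall x, `|f x| <= M) ->
    (fun n => (\int[mu]_w (f (X n w))%:E)%E) @ \oo -->
      (\int[normal_prob m s]_x (f x)%:E)%E.

(* T t x = number of topplings at x up to time t (only t >= 0 matters). *)

(* left_val T t x n : n = T(t-, x), the left limit; T(0-,x) := 0. *)
Definition left_val (R : realType) (T : R -> int -> nat) (t : R) (x : int)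
    (n : nat) : Prop :=
  (t = 0 /\ n = 0%N) \/
  (0 < t /\ exists2 d : R, 0 < d & forall s, 0 <= s -> t - d < s -> s < t -> T s x = n).

Definition topples_at (R : realType) (T : R -> int -> nat) (t : R) (x : int)
  : Prop := 0 <= t /\ exists2 n, left_val T t x n & (n < T t x)%N.

Definition is_toppling_procedure (R : realType) (T : R -> int -> nat) : Prop :=
  (forall x, T 0 x = 0%N) /\
  (forall x t, 0 <= t -> exists2 d : R, 0 < d &
      forall s, t <= s -> s < t + d -> T s x = T t x) /\
  (forall x s t, 0 <= s -> s <= t -> (T s x <= T t x)%N) /\
  (forall x t n, 0 <= t -> left_val T t x n -> (T t x <= n.+1)%N) /\
  (forall x (b : R), finite_set [set t | t <= b /\ topples_at T t x]) /\
  ~ (exists (xs : nat -> int) (ts : nat -> R),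
       forall k, topples_at T (ts k) (xs k) /\
                 `|xs k.+1 - xs k| = 1 /\ ts k.+1 < ts k).

(* eta - Delta T at site x, as an integer; Delta_{x,y}=2[x=y]-[|x-y|=1]. *)
Definition after_topplings (eta : config) (F : int -> nat) (x : int) : int :=
  (eta x)%:Z - 2 * (F x)%:Z + (F (x - 1))%:Z + (F (x + 1))%:Z.

Definition legal (R : realType) (eta : config) (T : R -> int -> nat) : Prop :=
  forall t x, topples_at T t x ->
    forall F : int -> nat, (forall y, left_val T t y (F y)) ->
      2 <= after_topplings eta F x.

Definition stabilizable (R : realType) (eta : config) : Prop :=
  exists T : R -> int -> nat,
    is_toppling_procedure T /\ legal eta T /\
    exists Tinf : int -> nat,
      (forall x, exists2 t0 : R, 0 <= t0 &
          forall t, t0 <= t -> T t x = Tinf x) /\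
      (forall x, after_topplings eta Tinf x <= 1).

Definition stabilizable_measure (R : realType) (mu : probability Config R)
  : Prop := {ae mu, forall eta : Config, stabilizable R eta}.

(* Main.v *)
Require Import Defs.
From HB Require Import structures.
From mathcomp Require Import all_boot all_order all_algebra.
From mathcomp Require Import all_classical all_reals all_analysis.
From mathcomp Require Import measurable_realfun zify lra.
Import Order.TTheory GRing.Theory Num.Theory.
Import numFieldNormedType.Exports.
Local Open Scope classical_set_scope.
Local Open Scope ring_scope.

(** Iterating u(x) <- floor((eta(x) + u(x-1) + u(x+1)) / 2) from u = 0 gives an
    increasing sequence that stays below every F with eta - Delta F <= 1, so for
    a stabilizable eta it converges to a limit u that is measurable, commutes
    with translations and leaves a final height xi = eta - Delta u in {0, 1}.
    With D(x) := u(x) - u(x-1) one has xi(x) = eta(x) + D(x+1) - D(x): the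
    difference xi - eta is an integrable coboundary of a stationary process,
    hence has mean 0, so E xi = 1 and xi = 1 almost surely. The sum of
    eta - 1 over an interval then telescopes to a difference of two values of
    the stationary process D, which is tight, and vanishes in probability after
    division by sqrt n. This contradicts a limit without an atom at 0. *)

(** * Monotone iteration towards the least stabilizing odometer *)

Fixpoint odometer_iter (eta : config) (k : nat) (x : int) : nat :=
  if k is k'.+1 then
    ((eta x + odometer_iter eta k' (x - 1)%R +
      odometer_iter eta k' (x + 1)%R)./2)%N
  else 0%N.

Lemma odometer_iter_leS (eta : config) k x :
  (odometer_iter eta k x <= odometer_iter eta k.+1 x)%N.
Proof.
elim: k x => [//|k IH] x; rewrite /= half_leq// !leq_add//; exact: IH.
Qed.

Lemma odometer_iter_homo (eta : config) x :
  {homo (odometer_iter eta ^~ x) : k l / (k <= l)%N}.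
Proof.
by apply: homo_leq => [//|l k n|k]; [exact: leq_trans|exact: odometer_iter_leS].
Qed.

(** Least action principle: stability at [x] reads [eta x + F (x - 1) + F (x + 1) <= 2 * F x + 1],
    so half of the left side, rounded down, is at most [F x]. Replacing [F] by smaller values at the
    neighbours only decreases it. *)
Lemma odometer_iter_le (eta : config) (F : int -> nat) :
  (forall x, after_topplings eta F x <= 1) ->
  forall k x, (odometer_iter eta k x <= F x)%N.
Proof.
move=> HF; elim=> [//|k IH] x /=.
have := HF x; rewrite /after_topplings; have := IH (x - 1); have := IH (x + 1).
by move: (odometer_iter _ _ _) (odometer_iter _ _ _) => a b; lia.
Qed.

Lemma odometer_iter_shift (eta : Config) k x :
  odometer_iter (Defs.shift eta) k x = odometer_iter eta k (x + 1).
Proof.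
elim: k x => //= k IH x; rewrite !IH /Defs.shift.
by rewrite (_ : x - 1 + 1 = x + 1 - 1)//; lia.
Qed.

(** Induction on the bound: either [F] already bounds the sequence, or the value [F.+1] is attained
    and monotonicity freezes the sequence from there on. *)
Lemma bounded_nat_eventually_constant (a : nat -> nat) (F : nat) :
  {homo a : k l / (k <= l)%N} -> (forall k, (a k <= F)%N) ->
  exists K, forall k, (K <= k)%N -> a k = a K.
Proof.
move=> hm; elim: F => [|F IH] hF.
  by exists 0%N => k _; have := hF k; have := hF 0%N; lia.
have [h|] := pselect (forall k, (a k <= F)%N); first exact: IH.
move=> /existsNP[K /negP hK]; exists K => k /hm; have := hF k; have := hF K; lia.
Qed.

(** * The limit odometer, its gradient and the final height *)

Section odometer.
Context {R : realType}.

(** A supremum in the extended reals makes this total and measurable; where the iteration diverges,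
    [fine] returns the default value 0. Other sites are reached by shifting the configuration. *)
Definition odometer_at0 (eta : Config) : R :=
  fine (ereal_sup (range (fun k => ((odometer_iter eta k 0)%:R : R)%:E))).

Lemma odometer_at0E (eta : Config) K :
  (forall k, (K <= k)%N -> odometer_iter eta k 0 = odometer_iter eta K 0) ->
  odometer_at0 eta = (odometer_iter eta K 0)%:R.
Proof.
move=> h; rewrite /odometer_at0.
suff -> : ereal_sup (range (fun k => ((odometer_iter eta k 0)%:R : R)%:E)) =
          ((odometer_iter eta K 0)%:R)%:E by [].
apply/eqP; rewrite eq_le; apply/andP; split; last first.
  by apply: ereal_sup_ubound; exists K.
apply: ge_ereal_sup => _ [k _ <-]; rewrite lee_fin ler_nat.
rewrite -(h (maxn k K) (leq_maxr _ _)); exact/odometer_iter_homo/leq_maxl.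
Qed.

(** Ties the stationary process to the iteration at site [j]. Equality for every [k >= K] lets
    several sites share one index. *)
Lemma odometer_at0_iter_shift (eta : Config) (F : int -> nat) (j : nat) :
  (forall x, after_topplings eta F x <= 1) ->
  exists K, forall k, (K <= k)%N ->
    odometer_at0 (iter j Defs.shift eta) = (odometer_iter eta k j%:Z)%:R.
Proof.
move=> hF.
have sE k : odometer_iter (iter j Defs.shift eta) k 0 = odometer_iter eta k j%:Z.
  suff H x : odometer_iter (iter j Defs.shift eta) k x =
      odometer_iter eta k (x + j%:Z).
    by rewrite H add0r.
  elim: j x => [|j IH] x /=; first by rewrite addr0.
  by rewrite odometer_iter_shift IH; congr (odometer_iter _ _ _); lia.
have [K HK] := bounded_nat_eventually_constant _ _ (odometer_iter_homo eta j%:Z)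
  (fun k => odometer_iter_le _ _ hF k j%:Z).
exists K => k Kk; rewrite (@odometer_at0E _ K).
  by rewrite sE (HK k Kk).
by move=> l Kl; rewrite !sE HK.
Qed.

(** This is [D(1)], taken in the reals since it may be negative. *)
Definition odometer_grad (eta : Config) : R :=
  odometer_at0 (Defs.shift eta) - odometer_at0 eta.

(** The final height [xi(1) = eta(1) + u(2) - 2 u(1) + u(0)]. Site 1 is the first whose left
    neighbour is reached without shifting backwards. *)
Definition stabilized_at1 (eta : Config) : R :=
  (eta 1)%:R + (odometer_grad (Defs.shift eta) - odometer_grad eta).

(* In the limit [u x = (eta x + u (x - 1) + u (x + 1))./2], so the final height
   is the remainder of a division by 2. *)
Lemma stabilized_at1_bounds (eta : Config) : stabilizable R eta ->
  0 <= stabilized_at1 eta <= 1.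
Proof.
move=> [_ [_ [_ [F [_ hF]]]]].
have [K0 H0] := @odometer_at0_iter_shift _ _ 0 hF.
have [K1 H1] := @odometer_at0_iter_shift _ _ 1 hF.
have [K2 H2] := @odometer_at0_iter_shift _ _ 2 hF.
pose K := maxn K0 (maxn K1 K2).
have e0 : odometer_at0 eta = (odometer_iter eta K 0)%:R by apply: H0; lia.
(* The index [K.+1] here, against [K] at sites 0 and 2, makes one unfolding of the recursion relate
   the three values. *)
have e1 : odometer_at0 (Defs.shift eta) = (odometer_iter eta K.+1 1%R)%:R.
  by apply: H1; lia.
have e2 : odometer_at0 (Defs.shift (Defs.shift eta)) =
    (odometer_iter eta K 2%:Z)%:R by apply: H2; lia.
rewrite /stabilized_at1 /odometer_grad e0 e1 e2 /= subrr.
rewrite (_ : (1 + 1)%R = 2%:Z :> int)//.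
move: (eta 1%R) (odometer_iter eta K 0%R) (odometer_iter eta K 2%:Z) => e b c.
move Ea : _./2 => a.
have : ((a + a <= e + b + c) /\ (e + b + c <= a + a + 1))%N by lia.
by rewrite -!(ler_nat R) !natrD => -[]; lra.
Qed.

(** * Measurability on the configuration space *)

Lemma measurable_site (x : int) :
  measurable_fun [set: Config] (fun eta : Config => eta x).
Proof.
move=> _ B _; rewrite setTI.
rewrite (_ : _ @^-1` B = \bigcup_(n in B) [set eta : Config | eta x = n]).
  apply: bigcup_measurable => n _; apply: sub_sigma_algebra; by exists x, n.
apply/seteqP; split => [eta Be|eta [n Bn en]]; first by exists (eta x).
by rewrite /= en.
Qed.

Lemma measurable_shift :
  measurable_fun [set: Config] (Defs.shift : Config -> Config).
Proof.
apply: (@measurability _ _ Config Config setT Defs.shift cylinders) => //.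
move=> _ [_ [x [n ->]] <-].
by rewrite setTI; apply: sub_sigma_algebra; exists (x + 1), n.
Qed.

Lemma measurable_odometer_iter k x :
  measurable_fun [set: Config] (fun eta : Config => odometer_iter eta k x).
Proof.
elim: k x => [x|k IH x /=]; first exact: measurable_cst.
apply: (@measurableT_comp _ _ _ _ _ _ half) => //.
apply: measurable_fun_addn => //; apply: measurable_fun_addn => //.
exact: measurable_site.
Qed.

Lemma measurable_natr (d : measure_display) (T : measurableType d) (f : T -> nat) :
  measurable_fun [set: T] f -> measurable_fun [set: T] (fun x => (f x)%:R : R).
Proof.
by move=> mf; apply: (@measurableT_comp _ _ _ _ _ _ (fun n : nat => n%:R : R)).
Qed.

Lemma measurable_odometer_at0 : measurable_fun [set: Config] odometer_at0.
Proof.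
apply: measurableT_comp => //.
rewrite (_ : (fun eta => _) =
    (fun eta : Config => esups (fun k => ((odometer_iter eta k 0)%:R : R)%:E) 0)).
  apply: measurable_fun_esups => k.
  apply/measurable_EFinP; apply: measurable_natr.
  exact: measurable_odometer_iter.
apply/funext => eta; rewrite /esups /sdrop /=; congr (ereal_sup (image _ _)).
exact/seteqP.
Qed.

Lemma measurable_odometer_grad : measurable_fun [set: Config] odometer_grad.
Proof.
apply: measurable_funB; last exact: measurable_odometer_at0.
by apply: (measurableT_comp measurable_odometer_at0); exact: measurable_shift.
Qed.

Lemma measurable_stabilized_at1 : measurable_fun [set: Config] stabilized_at1.
Proof.
apply: measurable_funD; first by apply: measurable_natr; exact: measurable_site.
apply: measurable_funB; last exact: measurable_odometer_grad.
by apply: (measurableT_comp measurable_odometer_grad); exact: measurable_shift.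
Qed.

End odometer.

(** * Measure-preserving maps and coboundaries *)

Lemma ae_sub {R : realType} {d : measure_display} {T : measurableType d}
    (mu : {measure set T -> \bar R}) (P Q : set T) :
  {ae mu, forall x, P x} -> (forall x, P x -> Q x) -> {ae mu, forall x, Q x}.
Proof. by move=> aP PQ; apply: filterS aP. Qed.

Section measure_preserving.
Context {R : realType} {d : measure_display} {T : measurableType d}.
Variables (mu : probability T R) (theta : T -> T).
Hypothesis mtheta : measurable_fun [set: T] theta.
Hypothesis inv_theta : forall A, measurable A -> mu (theta @^-1` A) = mu A.

Lemma measurable_iter n : measurable_fun [set: T] (iter n theta).
Proof. by elim: n => [|n IH]; [exact: measurable_id|exact: measurableT_comp]. Qed.

Lemma invariant_iter n A : measurable A -> mu (iter n theta @^-1` A) = mu A.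
Proof.
move=> mA; elim: n => [//|n IH].
rewrite -IH -[RHS]inv_theta; last first.
  by rewrite -[X in measurable X]setTI; exact: measurable_iter.
by congr (mu _); apply/seteqP; split => x /=; rewrite -iterSr.
Qed.

Lemma ge0_integral_invariant (f : T -> \bar R) :
  measurable_fun [set: T] f -> (forall x, (0 <= f x)%E) ->
  (\int[mu]_x f (theta x) = \int[mu]_x f x)%E.
Proof.
move=> mf f0.
have := @ge0_integral_pushforward _ _ _ _ R _ mtheta mu setT f measurableT mf
  (fun y _ => f0 y).
rewrite preimage_setT => <-.
by apply: eq_measure_integral => A mA _; exact: inv_theta.
Qed.

Lemma bounded_integrable (f : T -> R) (M : R) :
  measurable_fun [set: T] f -> (forall x, `|f x| <= M) ->
  mu.-integrable [set: T] (EFin \o f).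
Proof.
move=> mf fM; apply: measurable_bounded_integrable => //.
- by apply: (le_lt_trans (probability_le1 mu measurableT)); exact: ltry.
- exists M; split; first exact: num_real.
  by move=> x Mx y _ /=; exact: le_trans (fM _) (ltW Mx).
Qed.

Lemma integral_invariant (f : T -> R) (M : R) :
  measurable_fun [set: T] f -> (forall x, `|f x| <= M) ->
  (\int[mu]_x (f (theta x))%:E = \int[mu]_x (f x)%:E)%E.
Proof.
move=> mf fM.
have mEf : measurable_fun [set: T] (EFin \o f) by exact/measurable_EFinP.
have iEf : mu.-integrable (theta @^-1` setT) ((EFin \o f) \o theta).
  rewrite preimage_setT; apply: (@bounded_integrable (f \o theta) M).
    exact: measurableT_comp.
  by move=> x; exact: fM.
have := integral_pushforward mtheta mEf iEf measurableT.
rewrite preimage_setT /= => <-.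
by apply: eq_measure_integral => A mA _; exact: inv_theta.
Qed.

Lemma ae_invariant (P : set T) : {ae mu, forall x, P x} ->
  {ae mu, forall x, P (theta x)}.
Proof.
move=> [N [mN N0 PN]]; exists (theta @^-1` N); split => //.
- by rewrite -[X in measurable X]setTI; exact: mtheta.
- by rewrite inv_theta.
- by move=> x /= nP; exact: PN.
Qed.

Let clip (K y : R) := Num.max (- K) (Num.min K y).

Let clip_lipschitz K a b : `|clip K a - clip K b| <= `|a - b|.
Proof.
rewrite /clip.
have hmax (c x y : R) : `|Num.max c x - Num.max c y| <= `|x - y|.
  have := ler_norm (x - y); have := lerNnormlW (lexx `|x - y|).
  by rewrite ler_norml; case: (lerP c x); case: (lerP c y); lra.
have hmin (c x y : R) : `|Num.min c x - Num.min c y| <= `|x - y|.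
  have := ler_norm (x - y); have := lerNnormlW (lexx `|x - y|).
  by rewrite ler_norml; case: (lerP c x); case: (lerP c y); lra.
exact: le_trans (hmax _ _ _) (hmin _ _ _).
Qed.

Let clip_bound K a : 0 <= K -> `|clip K a| <= K.
Proof.
move=> K0; rewrite /clip /Num.max /Num.min.
by repeat case: ifPn; rewrite -?leNgt => *; rewrite ler_norml; lra.
Qed.

Let clip_id K a : `|a| <= K -> clip K a = a.
Proof.
rewrite ler_norml /clip /Num.max /Num.min.
by repeat case: ifPn; rewrite -?leNgt => *; lra.
Qed.

(* [h] need not be integrable: only truncations of [h] are integrated. *)
Lemma integral_coboundary (h : T -> R) (g : T -> \bar R) :
  measurable_fun [set: T] h -> mu.-integrable [set: T] g ->
  {ae mu, forall x, (`|h (theta x) - h x|%:E <= g x)%E} ->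
  mu.-integrable [set: T] (fun x => (h (theta x) - h x)%:E) /\
  (\int[mu]_x (h (theta x) - h x)%:E = 0)%E.
Proof.
move=> mh ig hg.
have mht : measurable_fun [set: T] (h \o theta) by exact: measurableT_comp.
have mclip K (f : T -> R) : measurable_fun [set: T] f ->
    measurable_fun [set: T] (clip K \o f).
  move=> mf; apply: measurable_maxr; first exact: measurable_cst.
  by apply: measurable_minr => //; exact: measurable_cst.
(* The coboundary of [h] truncated at level [n] has integral 0 by invariance. It is dominated by [g]
   because [clip] is 1-Lipschitz, and it equals the original coboundary at [x] once [n] exceeds both
   values of [|h|]. *)
pose F (n : nat) x := (clip n%:R (h (theta x)) - clip n%:R (h x))%:E.
have mF n : measurable_fun [set: T] (F n).
  by apply/measurable_EFinP/measurable_funB; [exact: (mclip _ _ mht)|exact: mclip].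
have mG : measurable_fun [set: T] (fun x => (h (theta x) - h x)%:E).
  exact/measurable_EFinP/measurable_funB.
have FG : {ae mu, forall x, [set: T] x -> F ^~ x @ \oo --> (h (theta x) - h x)%:E}.
  apply: aeW => x _; apply: cvg_near_cst.
  near=> n; rewrite /F !clip_id//.
  - by near: n; exact: nbhs_infty_ger.
  - by near: n; exact: nbhs_infty_ger.
have Fg : {ae mu, forall x n, [set: T] x -> (`|F n x| <= g x)%E}.
  apply: filterS hg => x hg n _; apply: le_trans hg.
  by rewrite lee_fin; exact: clip_lipschitz.
have [iG _ cv] := dominated_convergence measurableT mF mG FG ig Fg.
have F0 n : (\int[mu]_x F n x = 0)%E.
  have ib (f : T -> R) : measurable_fun [set: T] f ->
      mu.-integrable [set: T] (EFin \o (clip n%:R \o f)).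
    move=> mf; apply: (@bounded_integrable _ n%:R); first exact: mclip.
    by move=> x; exact: clip_bound.
  rewrite /F; under eq_integral do rewrite EFinB.
  rewrite (integralB measurableT (ib _ mht) (ib _ mh)) /=.
  rewrite (@integral_invariant (clip n%:R \o h) n%:R); last 2 first.
  - exact: mclip.
  - by move=> x; exact: clip_bound.
  by rewrite subee//; exact: (integrable_fin_num measurableT (ib _ mh)).
have E : [sequence \int[mu]_x F n x]_n%E = cst 0%E by apply/funext.
split=> //; rewrite E in cv; exact: (cvg_unique _ cv (cvg_cst _)).
Unshelve. all: by end_near. Qed.

End measure_preserving.

(** * A test function detecting convergence in probability to 0 *)

Section truncated_norm.
Context {R : realType}.

(** Bounded and continuous, hence admissible for convergence in distribution, and zero only at 0. *)
Definition truncated_norm (x : R) : R := Num.min 1 `|x|.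

Lemma truncated_norm_ge0 x : 0 <= truncated_norm x.
Proof. by rewrite /truncated_norm le_min ler01 normr_ge0. Qed.

Lemma truncated_norm_le1 x : `|truncated_norm x| <= 1.
Proof. by rewrite ger0_norm ?truncated_norm_ge0// ge_min lexx. Qed.

Lemma truncated_norm_eq0 x : truncated_norm x = 0 -> x = 0.
Proof.
rewrite /truncated_norm; case: (lerP 1 `|x|) => [_ /eqP|_ /normr0_eq0//].
by rewrite oner_eq0.
Qed.

Lemma truncated_normB x y :
  truncated_norm (x - y) <= truncated_norm x + truncated_norm y.
Proof.
have := ler_normB x y; have := normr_ge0 x; have := normr_ge0 y.
rewrite /truncated_norm.
by case: (lerP 1 `|x|); case: (lerP 1 `|y|); case: (lerP 1 `|x - y|); lra.
Qed.

Lemma continuous_truncated_norm : continuous truncated_norm.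
Proof.
move=> x; apply: (@continuous_min R R (cst 1) (fun y => `|y|)).
  exact: cvg_cst.
exact: (@norm_continuous R R).
Qed.

Lemma measurable_truncated_norm : measurable_fun [set: R] truncated_norm.
Proof.
by apply: measurable_minr; [exact: measurable_cst|exact: normr_measurable].
Qed.

Lemma normal_prob_set1 (m s a : R) : normal_prob m s [set a] = 0%E.
Proof.
have /null_content_dominatesP := @normal_prob_dominates R m s.
by apply; [exact: measurable_set1|exact: lebesgue_measure_set1].
Qed.

(** A zero integral would concentrate the normal law on the zero set [{0}] of [truncated_norm], a
    null set by absolute continuity. *)
Lemma integral_normal_truncated_norm_neq0 (m s : R) :
  (\int[normal_prob m s]_x (truncated_norm x)%:E)%E <> 0%E.
Proof.
move=> I0.
have mf : measurable_fun [set: R] (fun x => (truncated_norm x)%:E).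
  by apply/measurable_EFinP; exact: measurable_truncated_norm.
have /(ae_eq_integral_abs (normal_prob m s) measurableT mf) [N [mN N0 HN]] :
    (\int[normal_prob m s]_x `|(truncated_norm x)%:E| = 0)%E.
  rewrite -[RHS]I0; apply: eq_integral => x _.
  by rewrite gee0_abs// lee_fin truncated_norm_ge0.
have : (normal_prob m s setT <= normal_prob m s (N `|` [set (0 : R)%R]))%E.
  apply: le_measure; rewrite ?inE//.
    by apply: measurableU => //; exact: measurable_set1.
  move=> x _; have [->|x0] := eqVneq x 0; first by right.
  by left; apply: HN => /= /(_ I) [] /truncated_norm_eq0/eqP; rewrite (negPf x0).
rewrite measureU0//; last exact: normal_prob_set1.
by rewrite [leRHS]N0 probability_setT lee_fin ler10.
Qed.

Lemma cvg_sqrtV_natr : (Num.sqrt (n%:R : R))^-1 @[n --> \oo] --> (0 : R).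
Proof.
apply/gtr0_cvgV0.
  by near=> n; rewrite sqrtr_gt0 ltr0n; near: n; exists 1%N.
apply/cvgryPge => M; near=> n.
(* For [n >= M ^+ 2]: [M <= |M| = sqrt (M ^+ 2) <= sqrt n]. *)
rewrite (le_trans (ler_norm _))// -sqrtr_sqr ler_sqrt//; near: n.
exact: nbhs_infty_ger.
Unshelve. all: by end_near. Qed.

(** A single finite function [h] is tight: [c n * h x] tends to 0 at each point, and the constant 1
    dominates. *)
Lemma cvg_integral_truncated_norm (d : measure_display) (T : measurableType d)
    (mu : probability T R) (h : T -> R) (c : nat -> R) :
  measurable_fun [set: T] h -> c n @[n --> \oo] --> (0 : R) ->
  (\int[mu]_x (truncated_norm (c n * h x))%:E)%E @[n --> \oo] --> 0%E.
Proof.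
move=> mh c0.
have mF n : measurable_fun [set: T] (fun x => (truncated_norm (c n * h x))%:E).
  apply/measurable_EFinP/(measurableT_comp measurable_truncated_norm).
  by apply: measurable_funM => //; exact: measurable_cst.
have F0 : {ae mu, forall x, [set: T] x ->
    (truncated_norm (c n * h x))%:E @[n --> \oo] --> cst 0%E x}.
  apply: aeW => x _; apply: cvg_EFin; first exact: nearW.
  rewrite [X in _ --> X](_ : _ = truncated_norm (0 * h x)); last first.
    by rewrite mul0r /truncated_norm normr0 /Num.min ltr10.
  apply: (cvg_comp (fun n => c n * h x) truncated_norm); last first.
    exact: continuous_truncated_norm.
  by apply: cvgM => //; exact: cvg_cst.
have i1 : mu.-integrable [set: T] (cst 1%E).
  apply: (bounded_integrable mu (cst 1) 1) => //.
  by move=> x /=; rewrite normr1.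
have F1 : {ae mu, forall x n, [set: T] x ->
    (`|(truncated_norm (c n * h x))%:E| <= cst 1 x)%E}.
  by apply: aeW => x n _; rewrite lee_fin truncated_norm_le1.
have [_ _] := dominated_convergence measurableT mF (measurable_cst _) F0 i1 F1.
by rewrite integral0.
Qed.

End truncated_norm.

(** * Stationary stabilizable configurations of mean 1 *)

Section stationary_configuration.
Context {R : realType}.
Variable mu : probability Config R.
Hypothesis mu_inv : translation_invariant mu.
Hypothesis mu_mean : (\int[mu]_eta ((eta 0)%:R : R)%:E)%E = 1%E.
Hypothesis mu_stab : stabilizable_measure mu.

Lemma integral_site1 : (\int[mu]_eta ((eta 1)%:R : R)%:E)%E = 1%E.
Proof.
rewrite -mu_mean -[RHS](ge0_integral_invariant mu _ measurable_shift mu_inv).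
- by apply: eq_integral => eta _; rewrite /Defs.shift add0r.
- by apply/measurable_EFinP/measurable_natr; exact: measurable_site.
- by move=> eta; rewrite lee_fin.
Qed.

(* Conservation of mass: the final height has mean [1] and is at most [1]. *)
Lemma ae_stabilized_at1 : {ae mu, forall eta : Config, stabilized_at1 eta = 1 :> R}.
Proof.
have mN1 : measurable_fun [set: Config] (fun eta : Config => ((eta 1)%:R : R)).
  by apply: measurable_natr; exact: measurable_site.
have mN1E : measurable_fun [set: Config] (fun eta : Config => ((eta 1)%:R : R)%:E).
  exact/measurable_EFinP.
have iN1 : mu.-integrable [set: Config] (fun eta : Config => ((eta 1)%:R : R)%:E).
  apply/integrableP; split => //.
  under eq_integral do rewrite gee0_abs ?lee_fin//.
  by rewrite integral_site1 ltry.
have i1 : mu.-integrable [set: Config] (cst 1%E).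
  apply: (bounded_integrable mu (cst 1) 1) => //.
  by move=> x /=; rewrite normr1.
have bnd : {ae mu, forall eta : Config, 0 <= (stabilized_at1 eta : R) <= 1}.
  by apply: (ae_sub mu _ _ mu_stab) => eta; exact: stabilized_at1_bounds.
have [iD D0] : mu.-integrable setT
      (fun x => (odometer_grad (Defs.shift x) - odometer_grad x : R)%:E) /\
    (\int[mu]_x (odometer_grad (Defs.shift x) - odometer_grad x : R)%:E = 0)%E.
  (* The dominating function is [eta 1 + 1], since the coboundary is [xi(1) - eta(1)] with [xi(1)]
     in [[0, 1]]. *)
  apply: (integral_coboundary mu _ measurable_shift mu_inv _ _
    measurable_odometer_grad (integrableD measurableT iN1 i1)).
  apply: (ae_sub mu _ _ bnd) => eta; rewrite /stabilized_at1 lee_fin ler_norml.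
  have H (a b : R) : 0 <= b -> 0 <= b + a <= 1 -> - (b + 1) <= a <= b + 1 by lra.
  exact: H.
have I0 : (\int[mu]_eta (1 - stabilized_at1 eta : R)%:E = 0)%E.
  have E (eta : Config) : (1 - stabilized_at1 eta : R)%:E =
      (cst 1 eta - ((eta 1)%:R)%:E -
       (odometer_grad (Defs.shift eta) - odometer_grad eta)%:E)%E.
    by rewrite -!EFinB /stabilized_at1 opprD addrA.
  under eq_integral do rewrite E.
  rewrite (integralB measurableT (integrableB measurableT i1 iN1) iD).
  rewrite (integralB measurableT i1 iN1) D0 integral_site1 integral_cst//.
  by rewrite mul1e [X in (X - _ - _)%E](probability_setT mu) sube0 subee.
have mX : measurable_fun [set: Config] (fun eta => (1 - stabilized_at1 eta : R)%:E).
  apply/measurable_EFinP/measurable_funB; first exact: measurable_cst.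
  exact: measurable_stabilized_at1.
(* As [1 - xi(1) >= 0] almost surely, its zero mean is that of its absolute value, which forces it
   to vanish almost surely. *)
have : (\int[mu]_eta `|(1 - stabilized_at1 eta : R)%:E| = 0)%E.
  rewrite -[RHS]I0; apply: ae_eq_integral => //; first exact: measurableT_comp.
  by apply: (ae_sub mu _ _ bnd) => eta h _; rewrite gee0_abs// lee_fin; lra.
move/(ae_eq_integral_abs mu measurableT mX) => H.
apply: (ae_sub mu _ _ H) => eta /(_ I) [] h.
by lra.
Qed.

Lemma iter_shiftE n (eta : Config) x : iter n Defs.shift eta x = eta (x + n%:Z).
Proof.
elim: n x => [|n IH] x /=; first by rewrite addr0.
rewrite /Defs.shift IH; congr (eta _); lia.
Qed.

(** By invariance the final height is 1 at all sites [n + 1] at once, almost surely; then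
    [eta(i + 1) - 1 = D(i + 1) - D(i + 2)] telescopes. *)
Lemma ae_sum_site : {ae mu, forall eta : Config, forall n,
  \sum_(i < n) ((eta (i%:Z + 1))%:R - 1 : R) =
  odometer_grad eta - odometer_grad (iter n Defs.shift eta)}.
Proof.
have /ae_foralln H : forall n, {ae mu, forall eta : Config,
    stabilized_at1 (iter n Defs.shift eta) = 1 :> R}.
  move=> n; apply: (ae_invariant mu _ (measurable_iter _ measurable_shift n) _
    (fun eta => stabilized_at1 eta = 1)); last exact: ae_stabilized_at1.
  exact: invariant_iter measurable_shift mu_inv n.
apply: (ae_sub mu _ _ H) => eta {}H; elim=> [|n IH].
  by rewrite big_ord0 /= subrr.
rewrite big_ord_recr IH /=.
have := H n; rewrite /stabilized_at1 iter_shiftE addrC (addrC 1); lra.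
Qed.

Lemma measurable_Sn n : measurable_fun [set: Config] (@Sn R n).
Proof.
apply: measurable_funM; first exact: measurable_cst.
apply: measurable_sum => i; apply: measurable_funB; last exact: measurable_cst.
by apply: measurable_natr; exact: measurable_site.
Qed.

(** After telescoping, [Sn] is a scaled difference of two translates of the gradient; subadditivity
    of [truncated_norm] separates them and stationarity gives both the same integral. *)
Lemma integral_truncated_norm_Sn_le n :
  (\int[mu]_eta (truncated_norm (Sn R n eta))%:E <=
   \int[mu]_eta (truncated_norm ((Num.sqrt n%:R)^-1 * odometer_grad eta))%:E +
   \int[mu]_eta (truncated_norm ((Num.sqrt n%:R)^-1 * odometer_grad eta))%:E)%E.
Proof.
pose f (eta : Config) : \bar R :=
  (truncated_norm ((Num.sqrt n%:R)^-1 * odometer_grad eta))%:E.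
have mf : measurable_fun [set: Config] f.
  apply/measurable_EFinP/(measurableT_comp measurable_truncated_norm).
  by apply: measurable_funM; [exact: measurable_cst|
    exact: measurable_odometer_grad].
have mS : measurable_fun [set: Config]
    (fun eta => (truncated_norm (Sn R n eta))%:E).
  apply/measurable_EFinP/(measurableT_comp measurable_truncated_norm).
  exact: measurable_Sn.
have f0 eta : (0 <= f eta)%E by rewrite lee_fin truncated_norm_ge0.
have mit k := measurable_iter _ measurable_shift k.
have iit k := invariant_iter mu _ measurable_shift mu_inv k.
(* Shifting by [n.+1] moves the window from [-n, ..., n] to [1, ..., 2n + 1], where [ae_sum_site]
   applies. *)
rewrite -[leLHS](ge0_integral_invariant mu _ (mit n.+1) (iit n.+1))//; last first.
  by move=> x; rewrite lee_fin truncated_norm_ge0.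
rewrite -[X in (_ <= X + X)%E]/(\int[mu]_eta f eta)%E.
(* The second copy is moved to the far end of the telescoped sum, [(2 * n).+1] sites away. *)
rewrite -[X in (_ <= _ + X)%E](ge0_integral_invariant mu _
  (mit (2 * n).+1) (iit _) f)//.
have mfit := measurableT_comp mf (mit (2 * n).+1).
rewrite -ge0_integralD//.
apply: ae_ge0_le_integral => //.
- by move=> x _; rewrite lee_fin truncated_norm_ge0.
- by apply: (measurableT_comp mS); exact: mit.
- by move=> x _; rewrite adde_ge0.
- by apply: emeasurable_funD => //; exact: mfit.
apply: (ae_sub mu _ _ ae_sum_site) => eta H _.
rewrite /f -EFinD lee_fin.
suff -> : Sn R n (iter n.+1 Defs.shift eta) =
    (Num.sqrt n%:R)^-1 * odometer_grad eta -
    (Num.sqrt n%:R)^-1 * odometer_grad (iter (2 * n).+1 Defs.shift eta).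
  exact: truncated_normB.
rewrite -mulrBr -H /Sn; congr (_ * _); apply: eq_bigr => i _.
by rewrite iter_shiftE; congr ((eta _)%:R - 1); lia.
Qed.

Lemma cvg_integral_truncated_norm_Sn :
  (\int[mu]_eta (truncated_norm (Sn R n eta))%:E)%E @[n --> \oo] --> 0%E.
Proof.
have c0 := cvg_integral_truncated_norm _ _ mu _ _
  measurable_odometer_grad cvg_sqrtV_natr.
apply: (squeeze_cvge _ (cvg_cst 0%E)); last first.
  by rewrite -[X in _ --> X]adde0; apply: cvgeD; [by []|exact: c0|exact: c0].
apply: nearW => n; rewrite integral_truncated_norm_Sn_le andbT.
by apply: integral_ge0 => eta _; rewrite lee_fin truncated_norm_ge0.
Qed.

End stationary_configuration.

Theorem theorem3p5 (R : realType) (mu : probability Config R) :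
  translation_invariant mu ->
  (\int[mu]_eta ((eta 0 : nat)%:R : R)%:E)%E = 1%E ->
  (exists (m s : R), 0 < s /\
     cvg_in_distribution_normal mu (@Sn R) m s) ->
  ~ stabilizable_measure mu.
Proof.
move=> mu_inv mu_mean [m [s [_ cvS]]] mu_stab.
(* Tested on [truncated_norm], the same integrals converge to the nonzero normal integral and to
   0. *)
have {}cvS := cvS truncated_norm continuous_truncated_norm
  (ex_intro _ 1 truncated_norm_le1).
have cv0 := cvg_integral_truncated_norm_Sn mu mu_inv mu_mean mu_stab.
exact: (integral_normal_truncated_norm_neq0 m s) (cvg_unique _ cvS cv0).
Qed.
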